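(* Let $k,n\ge 1$ be integers, let $\mathbf{e}\in\mathbb{R}^k$ be a unit vector, and let $\lambda\in(0,\infty)$. Let $\mathbf{X}_1,\dots,\mathbf{X}_n$ be independent random vectors in $\mathbb{R}^k$ with densities $p_1,\dots,p_n$ with respect to Lebesgue measure. Assume that for each $i\in\{1,\dots,n\}$ $$M_i:=\mathsf{E}\,e^{\lambda\,\mathbf{e}\mathbf{X}_i}=\int_{\mathbb{R}^k}e^{\lambda\,\mathbf{e}\mathbf{x}}p_i(\mathbf{x})\,d\mathbf{x}<\infty,$$ and that for some $C_i\in(0,\infty)$ and some $\mu_i\in[0,\lambda)$ $$p_i(\mathbf{x})\le C_i\,e^{-\mu_i\,\mathbf{e}\mathbf{x}}\quad\text{for all }\mathbf{x}\in\mathbb{R}^k.$$ Let $p^{(n)}:=p_1*\dots*p_n$ be the convolution (the density of $\mathbf{X}_1+\dots+\mathbf{X}_n$), and let $$\varepsilon_i:=\lambda-\mu_i>0,\qquad \varepsilon^{(n)}:=\frac{1}{\frac1{\varepsilon_1}+\dots+\frac1{\varepsilon_n}}.$$ Then there exists a finite constant $K_n$, which depends only on the numbers $n$, $\lambda$, $\mu_i$, $M_i$, and $C_i$ ($i=1,\dots,n$), such that $$p^{(n)}(\mathbf{x})\le K_n\,e^{-(\lambda-\varepsilon^{(n)})\,\mathbf{e}\mathbf{x}}\quad\text{for all }\mathbf{x}\in\mathbb{R}^k.$$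
   Context: For $\mathbf{e},\mathbf{x}\in\mathbb{R}^k$, the juxtaposition $\mathbf{e}\mathbf{x}$ denotes the Euclidean scalar product. Convolution of densities is defined pointwise by $(p*q)(\mathbf{x})=\int_{\mathbb{R}^k}p(\mathbf{x}-\mathbf{u})q(\mathbf{u})\,d\mathbf{u}$; for $n=1$, $p^{(1)}=p_1$. *)

(* Defs.v *)
From HB Require Import structures.
From mathcomp Require Import all_boot all_order all_algebra.
From mathcomp Require Import all_classical all_reals all_analysis.

Set Implicit Arguments.
Unset Strict Implicit.
Unset Printing Implicit Defensive.

Import Order.TTheory GRing.Theory Num.Theory.
Import numFieldNormedType.Exports.

Local Open Scope classical_set_scope.
Local Open Scope ring_scope.

(* R^k is 'rV[R]_k. Its Borel sigma-algebra is the one generated by the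
   coordinate projections, as the library does for k.-tuple T. *)
Section rV_measurable.
Context (R : realType) (k : nat).

Definition rV_coord (i : 'I_k) (x : 'rV[R]_k) : measurableTypeR R := x ord0 i.

Let rV_set0 : g_sigma_preimage rV_coord set0.
Proof. exact: sigma_algebra0. Qed.

Let rV_setC A : g_sigma_preimage rV_coord A -> g_sigma_preimage rV_coord (~` A).
Proof. exact: sigma_algebraC. Qed.

Let rV_bigcup (F : (set 'rV[R]_k)^nat) :
  (forall i, g_sigma_preimage rV_coord (F i)) ->
  g_sigma_preimage rV_coord (\bigcup_i (F i)).
Proof. exact: sigma_algebra_bigcup. Qed.

HB.instance Definition _ := @isMeasurable.Build default_measure_display
  'rV[R]_k (g_sigma_preimage rV_coord) rV_set0 rV_setC rV_bigcup.

End rV_measurable.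

Section rV_measurable_fun.
Context (R : realType).

Lemma measurable_rV_coord k (i : 'I_k) :
  measurable_fun [set: 'rV[R]_k] (@rV_coord R k i).
Proof.
move=> _ Y mY; rewrite setTI; apply: sub_sigma_algebra => /=.
rewrite -bigcup_seq/=; exists i => /=; first by rewrite mem_index_enum.
by exists Y => //; rewrite setTI.
Qed.

Lemma measurable_fun_rVP d (T : measurableType d) k (f : T -> 'rV[R]_k) :
  measurable_fun [set: T] f <->
  forall i, measurable_fun [set: T] (@rV_coord R k i \o f).
Proof.
split=> [mf i|mf].
  by apply: measurableT_comp => //; exact: measurable_rV_coord.
have sub : g_sigma_preimage (fun i => @rV_coord R k i \o f) `<=` measurable.
  apply: smallest_sub; first exact: sigma_algebra_measurable.
  rewrite -bigcup_seq => A [i _ [B mB <-]].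
  exact: mf.
move: sub; rewrite g_sigma_preimage_comp => sub _ A mA.
by apply: sub; exists A.
Qed.

End rV_measurable_fun.

Section lebesgue_rV.
Context (R : realType).

Definition rV_cons k (z : measurableTypeR R * 'rV[R]_k) : 'rV[R]_k.+1 :=
  \row_i oapp (z.2 ord0) z.1 (unlift ord0 i).

Definition rV_uncons k (x : 'rV[R]_k.+1) : measurableTypeR R * 'rV[R]_k :=
  (x ord0 ord0, \row_i x ord0 (lift ord0 i)).

Lemma rV_consK k : cancel (@rV_cons k) (@rV_uncons k).
Proof.
move=> [a x]; rewrite /rV_uncons /rV_cons; congr pair.
  by rewrite mxE unlift_none.
by apply/rowP => i; rewrite !mxE liftK.
Qed.

Lemma rV_unconsK k : cancel (@rV_uncons k) (@rV_cons k).
Proof.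
move=> x; apply/rowP => i; rewrite !mxE.
by case: unliftP => [j ->|->] //=; rewrite mxE.
Qed.

Lemma measurable_rV_cons k : measurable_fun setT (@rV_cons k).
Proof.
apply/measurable_fun_rVP => i.
case: (unliftP ord0 i) => [j|] ->.
  rewrite (_ : _ \o _ = @rV_coord R k j \o snd); last first.
    by apply/funext => z /=; rewrite /rV_coord mxE liftK.
  by apply: measurableT_comp => //; exact: measurable_rV_coord.
rewrite (_ : _ \o _ = fst); first exact: measurable_fst.
by apply/funext => z /=; rewrite /rV_coord mxE unlift_none.
Qed.

Lemma measurable_rV_uncons k : measurable_fun setT (@rV_uncons k).
Proof.
apply/measurable_fun_pairP; split.
  rewrite (_ : _ \o _ = @rV_coord R k.+1 ord0) //.
  exact: measurable_rV_coord.
apply/measurable_fun_rVP => i.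
rewrite (_ : _ \o _ = @rV_coord R k.+1 (lift ord0 i)).
  exact: measurable_rV_coord.
by apply/funext => x /=; rewrite /rV_coord mxE.
Qed.

HB.instance Definition _ k :=
  isMeasurableFun.Build _ _ _ _ (@rV_cons k) (@measurable_rV_cons k).

Section step.
Context k (m : {sigma_finite_measure set 'rV[R]_k -> \bar R}).

Definition rV_measureS : set 'rV[R]_k.+1 -> \bar R :=
  pushforward (@lebesgue_measure R \x m)%E (@rV_cons k).

Let rV_measureS0 : rV_measureS set0 = 0%E.
Proof. exact: measure0. Qed.

Let rV_measureS_ge0 A : (0 <= rV_measureS A)%E.
Proof. exact: measure_ge0. Qed.

Let rV_measureS_sigma_additive : semi_sigma_additive rV_measureS.
Proof. exact: measure_semi_sigma_additive. Qed.

HB.instance Definition _ := isMeasure.Build _ _ _ rV_measureS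
  rV_measureS0 rV_measureS_ge0 rV_measureS_sigma_additive.

Let rV_measureS_sigma_finite : sigma_finite setT rV_measureS.
Proof.
have /sigma_finiteP[F [TF ndF Foo]] := sigma_finiteT (@lebesgue_measure R).
have /sigma_finiteP[G [TG ndG Goo]] := sigma_finiteT m.
exists (fun n => @rV_uncons k @^-1` (F n `*` G n)).
  apply/esym/seteqP; split=> // x _.
  have [n _ Fn] : (\bigcup_n F n) (x ord0 ord0) by rewrite -TF.
  have [l _ Gl] : (\bigcup_n G n) (\row_i x ord0 (lift ord0 i)) by rewrite -TG.
  exists (maxn n l) => //; split => /=.
    by move: Fn; exact/subsetPset/ndF/leq_maxl.
  by move: Gl; exact/subsetPset/ndG/leq_maxr.
move=> n; have [mF Ffin] := Foo n; have [mG Gfin] := Goo n; split.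
  rewrite -[X in measurable X]setTI; apply: measurable_rV_uncons => //.
  exact: measurableX.
rewrite /rV_measureS /pushforward -comp_preimage.
rewrite (_ : _ \o _ = id); last first.
  by apply/funext => z /=; rewrite rV_consK.
by rewrite preimage_id product_measure1E// lte_mul_pinfty// ge0_fin_numE.
Qed.

HB.instance Definition _ :=
  Measure_isSigmaFinite.Build _ _ _ rV_measureS rV_measureS_sigma_finite.

End step.

(* Lebesgue measure on R^k, as the k-fold product of the measure on R;
   R^0 is a point of mass 1. *)
Fixpoint lebesgue_rV k : {sigma_finite_measure set 'rV[R]_k -> \bar R} :=
  if k is k'.+1 then [the {sigma_finite_measure set _ -> \bar R} of
                       rV_measureS (lebesgue_rV k')]
  else [the {sigma_finite_measure set _ -> \bar R} of dirac (0 : 'rV[R]_0)].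

Lemma lebesgue_rV_box k (A : 'I_k -> set (measurableTypeR R)) :
  (forall i, measurable (A i)) ->
  lebesgue_rV k [set x | forall i, A i (x ord0 i)] =
  (\prod_(i < k) lebesgue_measure (A i))%E.
Proof.
elim: k A => [|k IH] A mA /=.
  rewrite big_ord0 /dirac indicE mem_set //; by case.
rewrite big_ord_recl -IH //.
have mbox : measurable [set x : 'rV[R]_k | forall i, A (lift ord0 i) (x ord0 i)].
  rewrite (_ : mkset _ = \bigcap_(i in [set: 'I_k])
      (@rV_coord R k i @^-1` A (lift ord0 i))).
    apply: fin_bigcap_measurable => [|i _]; first exact: finite_finset.
    by rewrite -[X in measurable X]setTI; exact: measurable_rV_coord.
  by apply/seteqP; split=> x /= xA i; [move=> _; exact: xA|exact: xA].
rewrite -product_measure1E // /rV_measureS /pushforward.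
congr (_ _); apply/seteqP; split=> -[a x] /=.
  move=> H; split; first by have := H ord0; rewrite mxE unlift_none.
  by move=> i; have := H (lift ord0 i); rewrite mxE liftK.
move=> [Aa Ax] i; rewrite mxE.
by case: unliftP => [j ->|->] //=; exact: Ax.
Qed.

End lebesgue_rV.

Section euclidean.
Context (R : realType) (k : nat).

Definition dotp (x y : 'rV[R]_k) : R := \sum_(i < k) x ord0 i * y ord0 i.

(* The library norm `|x| on 'rV[R]_k is the sup norm. *)
Definition enorm (x : 'rV[R]_k) : R := Num.sqrt (dotp x x).

(* The integrand is nonnegative wherever this is used, so the integral is
   defined, with values in [0, +oo], at every x. *)
Definition convolution (p q : 'rV[R]_k -> \bar R) (x : 'rV[R]_k) : \bar R :=
  (\int[lebesgue_rV R k]_u (p (x - u)%R * q u))%E.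

(* p_1 * ... * p_n, associated to the left; the value 0 for n = 0 is junk. *)
Definition iter_convolution (n : nat) (p : 'I_n -> 'rV[R]_k -> R) :
    'rV[R]_k -> \bar R :=
  if [seq EFin \o p i | i <- enum 'I_n] is p1 :: ps then
    foldl convolution p1 ps
  else cst 0%E.

End euclidean.

Section probability.
Context d (T : measurableType d) (R : realType) (P : probability T R).

Definition is_density k (X : {RV P >-> 'rV[R]_k}) (p : 'rV[R]_k -> R) : Prop :=
  [/\ measurable_fun setT p, forall x, 0 <= p x &
      forall A, measurable A ->
        distribution P X A = (\int[lebesgue_rV R k]_(x in A) (p x)%:E)%E].

Definition mutually_independent d' (V : measurableType d') n
    (X : 'I_n -> {RV P >-> V}) : Prop :=
  forall A : 'I_n -> set V, (forall i, measurable (A i)) ->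
    P (\bigcap_(i in [set: 'I_n]) X i @^-1` A i) =
    (\prod_(i < n) P (X i @^-1` A i))%E.

End probability.

(* Main.v *)
From HB Require Import structures.
Require Import Defs.
From mathcomp Require Import all_boot all_order all_algebra.
From mathcomp Require Import all_classical all_reals all_analysis.
From mathcomp Require Import measurable_realfun ring lra.

Set Implicit Arguments.
Unset Strict Implicit.
Unset Printing Implicit Defensive.

Import Order.TTheory GRing.Theory Num.Theory.
Import numFieldNormedType.Exports.

Local Open Scope classical_set_scope.
Local Open Scope ring_scope.

(** Tilting a density p to q(x) = exp(lambda e.x) p(x) turns the hypotheses into
    a bound on the mass of q_i, namely M_i, and an exponential bound
    q_i(x) <= C_i exp(e.x / r_i) with r_i = 1 / (lambda - mu_i).  Tilting
    commutes with convolution because x |-> exp(lambda e.x) is a character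
    ([convolution_tilt]), so it is enough to show that q_1 * ... * q_n grows at
    most like exp(e.x / (r_1 + ... + r_n)): untilting then gives the exponent
    lambda - epsilon^(n).

    For two functions, the value (q_1 * q_2)(x) is the integral of
    q_1(x - u) q_2(u).  Cut the space at the hyperplane
    e.u / r_2 = e.x / (r_1 + r_2).  On one side e.u / r_2 is at most
    e.x / (r_1 + r_2), on the other e.(x - u) / r_1 is, since the two numbers
    e.u and e.(x - u) add up to e.x.  So one of the two factors is always bounded
    by its constant times exp(e.x / (r_1 + r_2)), while the other factor has
    bounded integral; whence the constant C_1 M_2 + C_2 M_1
    ([convolution_le]).  By Tonelli and the invariance of Lebesgue measure under
    u |-> x - u, the mass of q_1 * q_2 is the product of the masses
    ([integral_convolution]), so the two kinds of bounds pass together to the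
    convolution ([tilt_dominated_convolution]) and the result follows by
    induction on the number of factors ([tilt_dominated_foldl]).

    The constant produced by the induction is computed from the C_i and M_i only;
    hence its uniformity in the dimension, the direction e and the densities. *)

(** * Lebesgue measure under point reflections *)

Section reflection.
Context (R : realType).

(** Typed on [measurableTypeR R], the sigma-algebra of the Lebesgue measure, so
    that the pushforward below is a measure on that space. *)
Definition point_reflection (a : R) : measurableTypeR R -> measurableTypeR R :=
  fun y => a - y.

Lemma measurable_point_reflection a : measurable_fun setT (point_reflection a).
Proof. exact: measurable_funB. Qed.

Lemma lebesgue_measure_reflect (a : R) (A : set (measurableTypeR R)) :
  measurable A ->
  pushforward lebesgue_measure (point_reflection a) A = lebesgue_measure A.
Proof.
move=> mA; apply/esym.
pose f : {mfun _ >-> _} := HB.pack (point_reflection a)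
  (isMeasurableFun.Build _ _ _ _ _ (measurable_point_reflection a)).
apply: (@lebesgue_measure_unique R (pushforward lebesgue_measure f)) => //=.
move=> _ [[b c]] _ <-; rewrite /pushforward.
rewrite (_ : _ @^-1` _ = `[a - c, a - b[%classic); last first.
  by apply/seteqP; split=> y /=; rewrite /point_reflection !in_itv/=;
    move=> /andP[? ?]; apply/andP; split; lra.
rewrite !lebesgue_measure_itv/= !lte_fin.
by rewrite -!EFinB ltrD2l ltrN2; case: ifP => // _; congr (_%:E); lra.
Qed.

Lemma ge0_integral_lebesgue_reflect (a : R) (f : measurableTypeR R -> \bar R) :
  measurable_fun setT f -> (forall x, 0 <= f x)%E ->
  (\int[lebesgue_measure]_x f (a - x)%R = \int[lebesgue_measure]_x f x)%E.
Proof.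
move=> mf f0.
have /= := @ge0_integral_pushforward _ _ _ _ R _ (measurable_point_reflection a)
  lebesgue_measure setT f measurableT mf (fun y _ => f0 y).
rewrite preimage_setT => <-.
apply: eq_measure_integral => [|? A mA _].
  exact: measurable_point_reflection.
exact: lebesgue_measure_reflect.
Qed.

Lemma measurable_fun_rVB d (T : measurableType d) k (f g : T -> 'rV[R]_k) :
  measurable_fun setT f -> measurable_fun setT g ->
  measurable_fun setT (fun x => f x - g x).
Proof.
move=> /measurable_fun_rVP mf /measurable_fun_rVP mg.
apply/measurable_fun_rVP => i.
rewrite (_ : _ \o _ =
    (fun x => (@rV_coord R k i \o f) x - (@rV_coord R k i \o g) x)).
  exact: (measurable_funB (mf i) (mg i)).
by apply/funext => x; rewrite /= /rV_coord !mxE.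
Qed.

(** One step of Fubini: integrals over R^(k+1) reduce to R x R^k, which makes
    induction on the dimension possible. *)
Lemma ge0_integral_lebesgue_rVS k (f : 'rV[R]_k.+1 -> \bar R) :
  measurable_fun setT f -> (forall x, 0 <= f x)%E ->
  (\int[lebesgue_rV R k.+1]_x f x =
   \int[lebesgue_measure]_a \int[lebesgue_rV R k]_v f (rV_cons (a, v)))%E.
Proof.
move=> mf f0.
have /= := @ge0_integral_pushforward _ _ _ _ R _ (@measurable_rV_cons R k)
  (@lebesgue_measure R \x lebesgue_rV R k)%E setT f measurableT mf
  (fun y _ => f0 y).
rewrite preimage_setT => ->.
rewrite fubini_tonelli1//.
by apply: measurableT_comp => //; exact: measurable_rV_cons.
Qed.

(** Coordinate by coordinate: x - (a, v) = (x_0 - a, x' - v), so the inner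
    integral is handled in dimension k and the outer one in dimension 1. *)
Lemma ge0_integral_lebesgue_rV_reflect k (x : 'rV[R]_k)
    (f : 'rV[R]_k -> \bar R) :
  measurable_fun setT f -> (forall x, 0 <= f x)%E ->
  (\int[lebesgue_rV R k]_u f (x - u)%R = \int[lebesgue_rV R k]_u f u)%E.
Proof.
elim: k x f => [|k IH] x f mf f0.
  by apply: eq_integral => u _; congr f; apply/rowP; case.
have mfB : measurable_fun setT (fun u : 'rV[R]_k.+1 => f (x - u)).
  by apply: measurableT_comp => //; exact: measurable_fun_rVB.
rewrite !ge0_integral_lebesgue_rVS//.
have consB (a : R) v : x - rV_cons (a, v) =
    rV_cons ((x ord0 ord0 - a)%R, ((rV_uncons x).2 - v)).
  apply/rowP => i; rewrite !mxE.
  by case: unliftP => [j ->|->] //=; rewrite !mxE.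
under eq_integral => a _.
  under eq_integral => v _ do rewrite consB.
  rewrite (IH _ (fun v => f (rV_cons (x ord0 ord0 - a, v)%R))); last 2 first.
  - apply: measurableT_comp => //; apply: measurableT_comp.
      exact: measurable_rV_cons.
    exact: measurable_pair1.
  - by [].
  over.
rewrite (ge0_integral_lebesgue_reflect _
  (f := fun a => (\int[lebesgue_rV R k]_v f (rV_cons (a, v)))%E))//.
- apply: (measurable_fun_fubini_tonelli_F (fun z => f (rV_cons z))) => //.
  by apply: measurableT_comp => //; exact: measurable_rV_cons.
- by move=> a; apply: integral_ge0.
Qed.

End reflection.

(** * Integration against a measure with a density *)

(** The Radon-Nikodym derivative of nu with respect to mu satisfies the change
    of variables formula; p has the same integrals as that derivative, hence
    agrees with it almost everywhere. *)
Lemma ge0_integral_density d (T : measurableType d) (R : realType)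
    (nu : {finite_measure set T -> \bar R})
    (mu : {sigma_finite_measure set T -> \bar R}) (p f : T -> \bar R) :
  measurable_fun setT p ->
  (forall A, measurable A -> nu A = \int[mu]_(x in A) p x)%E ->
  measurable_fun setT f -> (forall x, 0 <= f x)%E ->
  (\int[nu]_x f x = \int[mu]_x (f x * p x))%E.
Proof.
move=> mp nup mf f0.
have numu : nu `<< mu.
  apply/null_content_dominatesP => A mA muA0; rewrite nup//.
  exact: (null_set_integral mA (measurable_funTS mp)).
pose g := Radon_Nikodym_SigmaFinite.f nu mu.
have ig : mu.-integrable setT g.
  exact: Radon_Nikodym_SigmaFinite.f_integrable.
have mg := measurable_int mu ig.
rewrite -(Radon_Nikodym_SigmaFinite.change_of_variables numu)//.
apply: ae_eq_integral => //; try exact: emeasurable_funM.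
apply: ae_eqe_mul2l; apply: integral_ae_eq => // A _ mA.
by rewrite -Radon_Nikodym_SigmaFinite.f_integral// nup.
Qed.

Lemma expectation_density d (T : measurableType d) (R : realType)
    (P : probability T R) k (X : {RV P >-> 'rV[R]_k}) (p f : 'rV[R]_k -> R) :
  is_density X p -> measurable_fun setT f -> (forall x, 0 <= f x) ->
  ('E_P[f \o X] = \int[lebesgue_rV R k]_x ((f x)%:E * (p x)%:E))%E.
Proof.
move=> [mp p0 Xp] mf f0; rewrite unlock.
have mfE : measurable_fun setT (EFin \o f) by exact/measurable_EFinP.
rewrite -(ge0_integral_distribution X (f := EFin \o f))//.
apply: (ge0_integral_density (p := EFin \o p)) => //.
exact/measurable_EFinP.
Qed.

(** * Convolution of nonnegative functions *)

Section dotp.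
Context (R : realType) (k : nat) (e : 'rV[R]_k).

Lemma dotpB (x y : 'rV[R]_k) : dotp e (x - y) = dotp e x - dotp e y.
Proof.
by rewrite /dotp -sumrB; apply: eq_bigr => i _; rewrite !mxE mulrBr.
Qed.

Lemma measurable_dotp : measurable_fun setT (dotp e).
Proof.
apply: measurable_sum => i; apply: measurable_funM; first exact: measurable_cst.
exact: measurable_rV_coord.
Qed.

End dotp.

Section convolution.
Context (R : realType) (k : nat).
Implicit Types p q : 'rV[R]_k -> \bar R.
Local Open Scope ereal_scope.

Lemma convolution_ge0 p q :
  (forall x, 0 <= p x) -> (forall x, 0 <= q x) ->
  forall x, 0 <= convolution p q x.
Proof. by move=> p0 q0 x; apply: integral_ge0 => u _; exact: mule_ge0. Qed.

Lemma measurable_rV_reflect p (x : 'rV[R]_k) : measurable_fun setT p ->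
  measurable_fun setT (fun u : 'rV[R]_k => p (x - u)%R).
Proof.
move=> mp; apply: measurableT_comp => //.
by apply: measurable_fun_rVB.
Qed.

(** The translation by u is the composition of the reflections y |-> 0 - y and
    y |-> u - y. *)
Lemma ge0_integral_lebesgue_rV_translate p (u : 'rV[R]_k) :
  measurable_fun setT p -> (forall x, 0 <= p x) ->
  \int[lebesgue_rV R k]_x p (x - u)%R = \int[lebesgue_rV R k]_x p x.
Proof.
move=> mp p0; rewrite -(ge0_integral_lebesgue_rV_reflect 0%R mp)//.
rewrite -[RHS](@ge0_integral_lebesgue_rV_reflect _ _ u)//.
  by apply: eq_integral => x _; rewrite sub0r opprB.
exact: measurable_rV_reflect.
Qed.

Lemma measurable_convolution_integrand p q :
  measurable_fun setT p -> measurable_fun setT q ->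
  measurable_fun setT
    (fun z : 'rV[R]_k * 'rV[R]_k => p (z.1 - z.2)%R * q z.2).
Proof.
move=> mp mq; apply: emeasurable_funM.
  apply: measurableT_comp => //; apply: measurable_fun_rVB.
    exact: measurable_fst.
  exact: measurable_snd.
by apply: measurableT_comp => //; exact: measurable_snd.
Qed.

Lemma measurable_convolution p q :
  measurable_fun setT p -> measurable_fun setT q ->
  (forall x, 0 <= p x) -> (forall x, 0 <= q x) ->
  measurable_fun setT (convolution p q).
Proof.
move=> mp mq p0 q0.
apply: (measurable_fun_fubini_tonelli_F
  (fun z : 'rV[R]_k * 'rV[R]_k => p (z.1 - z.2)%R * q z.2)).
  exact: measurable_convolution_integrand.
by move=> z; exact: mule_ge0.
Qed.

Lemma integral_convolution p q :
  measurable_fun setT p -> measurable_fun setT q ->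
  (forall x, 0 <= p x) -> (forall x, 0 <= q x) ->
  \int[lebesgue_rV R k]_x convolution p q x =
  (\int[lebesgue_rV R k]_x p x) * (\int[lebesgue_rV R k]_x q x).
Proof.
move=> mp mq p0 q0.
rewrite (fubini_tonelli
  (fun z : 'rV[R]_k * 'rV[R]_k => p (z.1 - z.2)%R * q z.2)) /=; last 2 first.
- exact: measurable_convolution_integrand.
- by move=> z; exact: mule_ge0.
under eq_integral => u _.
  rewrite ge0_integralZr//; last first.
    apply: measurableT_comp => //.
    by apply: measurable_fun_rVB.
  rewrite ge0_integral_lebesgue_rV_translate//.
  over.
by rewrite ge0_integralZl//; exact: integral_ge0.
Qed.

(** The domain is split inside the integrand: at every u, one of the two
    summands of [pointwise] alone dominates the product p (x - u) q u, so the
    two integrals may be taken over the whole space. *)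
Lemma convolution_le (e : 'rV[R]_k) (r1 r2 M1 M2 C1 C2 : R) p q :
  (0 < r1)%R -> (0 < r2)%R ->
  measurable_fun setT p -> measurable_fun setT q ->
  (forall x, 0 <= p x) -> (forall x, 0 <= q x) ->
  \int[lebesgue_rV R k]_x p x <= M1%:E ->
  \int[lebesgue_rV R k]_x q x <= M2%:E ->
  (forall x, p x <= (C1 * expR (dotp e x / r1))%:E) ->
  (forall x, q x <= (C2 * expR (dotp e x / r2))%:E) ->
  forall x, convolution p q x <=
    ((C1 * M2 + C2 * M1) * expR (dotp e x / (r1 + r2)))%:E.
Proof.
move=> r1_gt0 r2_gt0 mp mq p0 q0 pM qM pC qC x.
have C1_ge0 : (0 <= C1)%R.
  have := le_trans (p0 0%R) (pC 0%R).
  by rewrite lee_fin pmulr_lge0// expR_gt0.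
have C2_ge0 : (0 <= C2)%R.
  have := le_trans (q0 0%R) (qC 0%R).
  by rewrite lee_fin pmulr_lge0// expR_gt0.
set w := expR (dotp e x / (r1 + r2)).
have w_ge0 : (0 <= w)%R by exact: expR_ge0.
have mpx := measurable_rV_reflect x mp.
have pointwise u : p (x - u)%R * q u <=
    (C2 * w)%:E * p (x - u)%R + (C1 * w)%:E * q u.
  have r12 : (0 < r1 + r2)%R by exact: addr_gt0.
  (* The case analysis is the position of u with respect to the cutting
     hyperplane; the bound on q is used below it, the bound on p above. *)
  have [h|h] := leP (dotp e u / r2)%R (dotp e x / (r1 + r2))%R.
    apply: (@le_trans _ _ ((C2 * w)%:E * p (x - u)%R)).
      rewrite muleC; apply: lee_wpmul2r => //.
      apply: (le_trans (qC u)); rewrite lee_fin.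
      by apply: ler_wpM2l => //; rewrite ler_expR.
    by rewrite leeDl// mule_ge0// lee_fin mulr_ge0.
  apply: (@le_trans _ _ ((C1 * w)%:E * q u)).
    apply: lee_wpmul2r => //.
    apply: (le_trans (pC _)); rewrite lee_fin.
    apply: ler_wpM2l => //; rewrite ler_expR dotpB.
    move: h; rewrite ltr_pdivlMr// => h.
    rewrite ler_pdivrMr//.
    (* e.x = t r1 + t r2 for t = e.x / (r1 + r2), and e.u > t r2, so that
       e.(x - u) < t r1. *)
    have : (dotp e x = dotp e x / (r1 + r2) * r1 + dotp e x / (r1 + r2) * r2)%R.
      by field; rewrite gt_eqF.
    lra.
  by rewrite leeDr// mule_ge0// lee_fin mulr_ge0.
rewrite /convolution.
apply: (@le_trans _ _ (\int[lebesgue_rV R k]_u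
    ((C2 * w)%:E * p (x - u)%R + (C1 * w)%:E * q u))).
  apply: ge0_le_integral => //.
  - by move=> u _; exact: mule_ge0.
  - exact: emeasurable_funM.
  - apply: emeasurable_funD; exact: measurable_funeM.
rewrite ge0_integralD//; last 4 first.
- by move=> u _; rewrite mule_ge0// lee_fin mulr_ge0.
- exact: measurable_funeM.
- by move=> u _; rewrite mule_ge0// lee_fin mulr_ge0.
- exact: measurable_funeM.
rewrite !ge0_integralZl//; try by rewrite lee_fin mulr_ge0.
rewrite ge0_integral_lebesgue_rV_reflect//.
rewrite (_ : ((C1 * M2 + C2 * M1) * w)%:E =
    (C2 * w)%:E * M1%:E + (C1 * w)%:E * M2%:E); last first.
  by rewrite -!EFinM -EFinD; congr EFin; ring.
by apply: leeD; apply: lee_wpmul2l => //; rewrite lee_fin mulr_ge0.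
Qed.

End convolution.

(** * Exponential tilting *)

Section tilt.
Context (R : realType) (k : nat) (e : 'rV[R]_k).
Local Open Scope ereal_scope.

Definition tilt (l : R) (p : 'rV[R]_k -> \bar R) (x : 'rV[R]_k) : \bar R :=
  (expR (l * dotp e x))%:E * p x.

Lemma tilt_ge0 l p : (forall x, 0 <= p x) -> forall x, 0 <= tilt l p x.
Proof. by move=> p0 x; rewrite mule_ge0// lee_fin expR_ge0. Qed.

Lemma tiltNK l p : tilt (- l) (tilt l p) = p.
Proof.
apply/funext => x.
by rewrite /tilt muleA -EFinM -expRD mulNr addNr expR0 mul1e.
Qed.

Lemma measurable_expR_dotp l :
  measurable_fun setT (fun x : 'rV[R]_k => (expR (l * dotp e x))%:E).
Proof.
apply/measurable_EFinP; apply: measurableT_comp => //.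
by apply: measurable_funM; [exact: measurable_cst|exact: measurable_dotp].
Qed.

Lemma measurable_tilt l p :
  measurable_fun setT p -> measurable_fun setT (tilt l p).
Proof.
by move=> mp; apply: emeasurable_funM => //; exact: measurable_expR_dotp.
Qed.

(** The weights multiply to exp(l e.x) under the integral, since
    e.(x - u) + e.u = e.x. *)
Lemma convolution_tilt l p q :
  measurable_fun setT p -> measurable_fun setT q ->
  (forall x, 0 <= p x) -> (forall x, 0 <= q x) ->
  convolution (tilt l p) (tilt l q) = tilt l (convolution p q).
Proof.
move=> mp mq p0 q0; apply/funext => x.
rewrite /tilt /convolution -ge0_integralZl//.
- apply: eq_integral => u _.
  rewrite muleACA -EFinM -expRD -mulrDr.
  by rewrite dotpB subrK.
- by apply: emeasurable_funM => //; exact: measurable_rV_reflect.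
- by move=> u _; exact: mule_ge0.
Qed.

(** The growth rate is recorded by its inverse r because under convolution the
    rates combine harmonically: it is their inverses that add. *)
Definition tilt_dominated (l r M C : R) (p : 'rV[R]_k -> \bar R) : Prop :=
  [/\ measurable_fun setT p, (forall x, 0 <= p x),
      \int[lebesgue_rV R k]_x tilt l p x <= M%:E &
      forall x, tilt l p x <= (C * expR (dotp e x / r))%:E].

Lemma tilt_dominated_convolution l r1 r2 M1 M2 C1 C2 p q :
  (0 < r1)%R -> (0 < r2)%R ->
  tilt_dominated l r1 M1 C1 p -> tilt_dominated l r2 M2 C2 q ->
  tilt_dominated l (r1 + r2) (M1 * M2) (C1 * M2 + C2 * M1) (convolution p q).
Proof.
move=> r1_gt0 r2_gt0 [mp p0 pM pC] [mq q0 qM qC].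
have mtp := measurable_tilt l mp; have mtq := measurable_tilt l mq.
have tp0 := tilt_ge0 l p0; have tq0 := tilt_ge0 l q0.
split.
- exact: measurable_convolution.
- exact: convolution_ge0.
- rewrite -convolution_tilt// integral_convolution// EFinM.
  by apply: lee_pmul => //; exact: integral_ge0.
- by rewrite -convolution_tilt//; exact: convolution_le.
Qed.

End tilt.

(** Here K is chosen before the dimension, the direction and the functions: it is
    obtained from (M0, C0) by iterating the map
    (M, C) |-> (M M_i, C M_i + C_i M) of [tilt_dominated_convolution]. *)
Lemma tilt_dominated_foldl (R : realType) (I : Type) (s : seq I) (l : R)
    (r M C : I -> R) (r0 M0 C0 : R) :
  (forall i, 0 < r i) -> 0 < r0 ->
  exists K : R, forall k (e : 'rV[R]_k) (q0 : 'rV[R]_k -> \bar R)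
      (q : I -> 'rV[R]_k -> \bar R),
    tilt_dominated e l r0 M0 C0 q0 ->
    (forall i, tilt_dominated e l (r i) (M i) (C i) (q i)) ->
    tilt_dominated e l (r0 + \sum_(i <- s) r i) (M0 * \prod_(i <- s) M i) K
      (foldl (@convolution R k) q0 [seq q i | i <- s]).
Proof.
move=> r_gt0; elim: s r0 M0 C0 => [|i s IH] r0 M0 C0 r0_gt0.
  by exists C0 => k e q0 q q0D qD; rewrite !big_nil addr0 mulr1.
have [K KP] := IH (r0 + r i) (M0 * M i) (C0 * M i + C i * M0)
  (addr_gt0 r0_gt0 (r_gt0 i)).
exists K => k e q0 q q0D qD; rewrite !big_cons addrA mulrA.
by apply: KP => //; exact: tilt_dominated_convolution.
Qed.

Theorem theorem2p1 (R : realType) (n : nat) (lambda : R)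
    (mu M C : 'I_n -> R)
    (n_ge1 : (1 <= n)%N) (lambda_gt0 : 0 < lambda)
    (mu_lambda : forall i, 0 <= mu i < lambda)
    (C_gt0 : forall i, 0 < C i) :
  let eps i := lambda - mu i in
  let epsn := (\sum_(i < n) (eps i)^-1)^-1 in
  exists K : R,
    forall (k : nat) (e : 'rV[R]_k)
      (d : measure_display) (T : measurableType d) (P : probability T R)
      (X : 'I_n -> {RV P >-> 'rV[R]_k}) (p : 'I_n -> 'rV[R]_k -> R),
      (1 <= k)%N ->
      enorm e = 1 ->
      mutually_independent X ->
      (forall i, is_density (X i) (p i)) ->
      (forall i, ('E_P[fun w => expR (lambda * dotp e (X i w))] = (M i)%:E)%E) ->
      (forall i x, p i x <= C i * expR (- (mu i * dotp e x))) ->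
      forall x : 'rV[R]_k,
        (iter_convolution p x <=
           (K * expR (- ((lambda - epsn) * dotp e x)))%:E)%E.
Proof.
move=> eps epsn.
have r_gt0 i : 0 < (eps i)^-1.
  by rewrite invr_gt0 subr_gt0; have /andP[] := mu_lambda i.
case enumE : (enum 'I_n) => [|i0 s].
  by exfalso; have := size_enum_ord n; rewrite enumE => n0; rewrite -n0 in n_ge1.
have [K KP] := tilt_dominated_foldl s lambda M C (M i0) (C i0) r_gt0 (r_gt0 i0).
exists K => k e d T P X p _ _ _ pX XM pC x.
pose q i := EFin \o p i.
have qD i : tilt_dominated e lambda (eps i)^-1 (M i) (C i) (q i).
  have [mp p0 _] := pX i; split.
  - exact/measurable_EFinP.
  - by move=> y; rewrite lee_fin.
  - rewrite -XM.
    have /measurable_EFinP mE := measurable_expR_dotp e lambda.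
    by rewrite (expectation_density (pX i) mE) // => y; exact: expR_ge0.
  - move=> y; rewrite /tilt -EFinM lee_fin invrK.
    rewrite (_ : dotp e y * eps i =
        lambda * dotp e y + - (mu i * dotp e y)); last by rewrite /eps; ring.
    by rewrite expRD mulrCA ler_wpM2l// expR_ge0.
have [_ _ _ /(_ x)] := KP k e (q i0) q (qD i0) qD.
have -> : (eps i0)^-1 + \sum_(i <- s) (eps i)^-1 = epsn^-1.
  by rewrite /epsn invrK -[RHS]big_enum enumE big_cons.
set f := foldl _ _ _ => fK.
have -> : iter_convolution p x = tilt e (- lambda) (tilt e lambda f) x.
  by rewrite tiltNK /iter_convolution enumE.
apply: (le_trans (lee_wpmul2l _ fK)); first by rewrite lee_fin expR_ge0.
rewrite -EFinM lee_fin mulrCA -expRD invrK.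
rewrite (_ : - lambda * dotp e x + _ = - ((lambda - epsn) * dotp e x))//.
by ring.
Qed.
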